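(* There is a real-valued function $\lambda$ such that for every starlike tree $S_n$ with $n$ vertices whose root has degree $m$, and for every integer $h>2$, $$P_h(S_n)=\lambda(n,m,h,L_1,\ldots,L_{h-3})+\mu(n,m,h,L_1,\ldots,L_{h-3})\,L_{h-2},\qquad \mu(n,m,h,L_1,\ldots,L_{h-3})=2-m,$$ where $L_l$ is the number of $l$-branches of $S_n$. That is, $\lambda(n,m,h,L_1,\ldots,L_{h-3})$ is a real number determined only by the values of $n,m,h,L_1,\ldots,L_{h-3}$ (for $h=3$, only by $n,m,h$).
   Context: Graphs are finite and simple. A path of length $h$ in $G$ is a subgraph that is a path with $h$ edges ($h+1$ distinct vertices); paths are undirected. $P_h(G)$ is the number of paths of length $h$ in $G$; it is $0$ if $h$ exceeds the length of a longest path of $G$. A starlike tree is a tree with exactly one vertex $v_0$ of degree greater than $2$; $v_0$ is called the root (center) and $m=d(v_0)$. An $l$-branch of $S_n$ is a path of length $l$ from $v_0$ to a pendant vertex (degree-one vertex), and $L_l$ is the number of $l$-branches ($L_l=0$ if there are none). *)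

(* Defs.v *)
From mathcomp Require Import all_boot all_order all_algebra.
From mathcomp Require Import reals.

Set Implicit Arguments.
Unset Strict Implicit.
Unset Printing Implicit Defensive.

Definition simple_graph (T : finType) (e : rel T) : Prop :=
  symmetric e /\ irreflexive e.

Definition degree (T : finType) (e : rel T) (v : T) : nat :=
  #|[set u | e v u]|.

(* Two adjacent vertices form an [ucycle] of size 2, hence the bound on the
   size of a graph cycle. *)
Definition is_tree (T : finType) (e : rel T) : Prop :=
  (forall x y : T, connect e x y) /\
  (forall s : seq T, 2 < size s -> ~ ucycle e s).

Definition starlike_tree (T : finType) (e : rel T) (v0 : T) : Prop :=
  is_tree e /\ (forall v : T, 2 < degree e v <-> v = v0).

Definition is_vertex_path (T : finType) (e : rel T) (s : seq T) : bool :=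
  uniq s && sorted e s.

(* The subgraph (vertex set, edge set) traversed by the vertex sequence [s].
   A sequence and its reversal traverse the same subgraph, so counting these
   subgraphs counts undirected paths. *)
Definition path_subgraph (T : finType) (s : seq T) :
    {set T} * {set {set T}} :=
  ([set x in s], [set [set p.1; p.2] | p in zip s (behead s)]).

Definition paths (T : finType) (e : rel T) (h : nat) :
    {set {set T} * {set {set T}}} :=
  [set path_subgraph t | t : h.+1.-tuple T & is_vertex_path e t].

Definition num_paths (T : finType) (e : rel T) (h : nat) : nat :=
  #|paths e h|.

Definition branches (T : finType) (e : rel T) (v0 : T) (l : nat) :
    {set {set T} * {set {set T}}} :=
  [set path_subgraph t | t : l.+1.-tuple T &
     [&& is_vertex_path e t, thead t == v0 & degree e (last v0 t) == 1]].

Definition num_branches (T : finType) (e : rel T) (v0 : T) (l : nat) : nat :=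
  #|branches e v0 l|.

(* Main.v *)
Require Import Defs.
From mathcomp Require Import all_boot all_order all_algebra.
From mathcomp Require Import reals zify ring.

(** Let [dist] be the distance in the tree, [N k] the number of vertices at
    distance [k] from the root [v0], and [C k], [Q k], [B k] the numbers of ordered
    pairs at distance [k] that are arbitrary, resp. start at a leaf, resp. consist
    of two leaves. For [k > 0] every vertex [y] at distance [k] from [x] has exactly
    [deg y - 1] neighbours at distance [k + 1] from [x], and [deg y = 2] except at
    the root and the leaves. Summing over all [x], over [x = v0] and over the
    leaves [x] gives
      [C (k+1) = C k + (m-2) * N k - Q k], [N (k+1) = N k - L k],
      [Q (k+1) = Q k + (m-2) * L k - B k],
    with [C 1 = 2n - 2] and [N 1 = Q 1 = m]. The path between two distinct leaves
    runs through the root, so [B k] depends on [L 1, ..., L (k-1)] only. Hence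
    [L (h-2)] enters [C h = 2 P_h] only through [N (h-1)] and [Q (h-1)], with total
    coefficient [-2(m-2)]. *)

Set Implicit Arguments.
Unset Strict Implicit.
Unset Printing Implicit Defensive.

(** * Subgraphs traversed by vertex sequences *)

Lemma mem_zip_behead (T : eqType) (s : seq T) a b :
  reflect (exists s1 s2, s = s1 ++ a :: b :: s2) ((a, b) \in zip s (behead s)).
Proof.
apply: (iffP idP) => [|[s1 [s2 ->]]].
  elim: s => [|x [|y s] IH] //=; rewrite inE => /orP[/eqP[-> ->]|/IH[s1 [s2 ->]]].
    by exists [::], s.
  by exists (x :: s1), s2.
by elim: s1 => [|x [|y s1] IH] /=; rewrite inE ?eqxx //= IH orbT.
Qed.

Lemma path_subgraph_rev (T : finType) (s : seq T) :
  path_subgraph (rev s) = path_subgraph s.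
Proof.
(* One inclusion for every [r] suffices: applied to [rev s] it gives the converse. *)
have sub (r : seq T) :
    (path_subgraph r).2 \subset (path_subgraph (rev r)).2.
  apply/subsetP=> _ /imsetP[[a b] /mem_zip_behead[s1 [s2 ->]] ->].
  apply/imsetP; exists (b, a); last by rewrite setUC.
  apply/mem_zip_behead; exists (rev s2), (rev s1).
  by rewrite rev_cat !rev_cons -!cats1 -!catA.
congr (_, _); first by apply/setP=> x; rewrite !inE mem_rev.
by apply/eqP; rewrite eqEsubset sub andbT; have := sub (rev s); rewrite revK.
Qed.

Lemma sum_mem (T : finType) (A B : {set T}) :
  \sum_(x in A) (x \in B) = #|B :&: A|.
Proof.
rewrite -sum1_card [LHS]big_mkcond [RHS]big_mkcond.
by apply: eq_bigr => x _; rewrite inE; do 2!case: (x \in _).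
Qed.

(** * Unique paths and distance in a tree *)

Section TreeDistance.

Variables (T : finType) (e : rel T).
Hypothesis eS : symmetric e.
Hypothesis eI : irreflexive e.
Hypothesis conn : forall x y, connect e x y.
Hypothesis acyc : forall s : seq T, 2 < size s -> ~ ucycle e s.

(* If the heads differ, the two paths up to the first vertex of [p] lying on [q]
   form a cycle. *)
Lemma tree_path_head x p q :
    path e x p -> uniq (x :: p) -> path e x q -> uniq (x :: q) ->
    p != [::] -> q != [::] -> last x p = last x q ->
  head x p = head x q.
Proof.
move=> pP uP pQ uQ p0 q0 eq_last; apply/eqP/negPn/negP => ab.
have last_mem s : s != [::] -> last x s \in s by case: s => //= ? ? _; apply: mem_last.
have hasPQ : has (mem q) p.
  by apply/hasP; exists (last x p); rewrite ?last_mem //= eq_last last_mem.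
case: (split_find hasPQ) pP uP ab {p0 eq_last} => z p1 p2 /= zq np1 pP uP ab.
case/splitPr: zq np1 pQ uQ ab {q0} => q1 q2 np1 pQ uQ ab.
apply: (@acyc (x :: p1 ++ z :: rev q1)).
  (* [p1] and [q1] are not both empty, since otherwise both heads would be [z]. *)
  rewrite /= size_cat /= size_rev.
  by case: p1 q1 ab {np1 pP uP pQ uQ} => [|? ?] [|? ?] //=; rewrite ?eqxx //; lia.
rewrite /ucycle; apply/andP; split.
  rewrite /= rcons_cat cat_path /=.
  move: pP pQ; rewrite cat_rcons !cat_path /=.
  move=> /and3P[-> -> _] /and3P[pq1 ezq1 _] /=.
  have := rev_path e x (rcons q1 z); rewrite last_rcons belast_rcons rev_cons => ->.
  by rewrite (eq_path (e' := e)) ?rcons_path ?pq1 // => u v; apply: eS.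
move: uP uQ; rewrite cat_rcons !(cons_uniq, cat_uniq, has_sym (_ :: _), mem_cat).
rewrite !(inE, negb_or, mem_rev, rev_uniq) -!andbA.
case/and5P=> -> xz _ -> /andP[zp1 _]; case/and5P=> -> _ _ -> /andP[zq1 _].
rewrite xz zp1 zq1 /= andbT; apply/hasPn => w; rewrite mem_rev => wq1.
by apply: contra np1 => wp1; apply/hasP; exists w; rewrite //= mem_cat wq1.
Qed.

Lemma tree_path_uniq x p q :
    path e x p -> uniq (x :: p) -> path e x q -> uniq (x :: q) ->
  last x p = last x q -> p = q.
Proof.
elim: p x q => [|a p IH] x [|b q] //.
- by move=> _ _ _ /= /andP[xq _] E; rewrite E mem_last in xq.
- by move=> _ /= /andP[xq _] _ _ E; rewrite -E mem_last in xq.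
move=> pP uP pQ uQ E.
have /= Eab := tree_path_head pP uP pQ uQ isT isT E; subst b.
move: pP uP pQ uQ => /andP[_ pP] /andP[_ uP] /andP[_ pQ] /andP[_ uQ].
by congr cons; apply: (IH a).
Qed.

Lemma ex_tpath x y : exists p, [&& path e x p, uniq (x :: p) & last x p == y].
Proof.
case/connectP: (conn x y) => p pP ->; case/shortenP: pP => q pQ uQ _.
by exists q; rewrite pQ uQ eqxx.
Qed.

(** The starting vertex is left out, so that the size is the number of edges. *)
Definition tpath x y : seq T := xchoose (ex_tpath x y).

Definition dist x y := size (tpath x y).

Lemma tpathP x y :
  [/\ path e x (tpath x y), uniq (x :: tpath x y) & last x (tpath x y) = y].
Proof. by case/and3P: (xchooseP (ex_tpath x y)) => ? ? /eqP. Qed.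

Lemma tpath_eq x y p :
  path e x p -> uniq (x :: p) -> last x p = y -> tpath x y = p.
Proof.
by move=> pP uP lP; case: (tpathP x y) => ? ? l; apply: (@tree_path_uniq x); rewrite ?l.
Qed.

Lemma distxx x : dist x x = 0.
Proof. by rewrite /dist (@tpath_eq x x [::]). Qed.

Lemma dist0_eq x y : dist x y = 0 -> x = y.
Proof. by case: (tpathP x y) => _ _; rewrite /dist; case: (tpath x y). Qed.

Lemma dist_eq0 x y : (dist x y == 0) = (x == y).
Proof. by apply/eqP/eqP => [/dist0_eq|->] //; rewrite distxx. Qed.

Lemma tpath_sym x y : y :: tpath y x = rev (x :: tpath x y).
Proof.
case: (tpathP x y) => pP uP lP.
rewrite [x :: _]lastI rev_rcons lP; congr cons.
case Ep: (tpath x y) pP uP lP => [|a p] pP uP lP; first by rewrite -lP (@tpath_eq x x [::]).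
apply: tpath_eq.
- rewrite -{1}lP rev_path (eq_path (e' := e)) // => u v; exact: eS.
- move: uP; rewrite lastI lP -rev_uniq rev_rcons //.
- by rewrite /= rev_cons last_rcons.
Qed.

Lemma dist_sym x y : dist x y = dist y x.
Proof. by have /(congr1 size) := tpath_sym x y; rewrite size_rev /= => -[]. Qed.

Lemma tpath_split x y z : z \in x :: tpath x y -> tpath x y = tpath x z ++ tpath z y.
Proof.
case: (tpathP x y) => pP uP lP zp.
case/splitPl: zp pP uP lP => p1 p2 lz; rewrite cat_path -cat_cons cat_uniq last_cat lz.
case/andP=> pP1 pP2 /and3P[u1 dj u2] lP.
rewrite (@tpath_eq x z p1) // (@tpath_eq z y p2) //=.
by rewrite u2 andbT; apply: contra dj => zp2; apply/hasP; exists z; rewrite // -lz mem_last.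
Qed.

Lemma dist_split x y z : z \in x :: tpath x y -> dist x y = dist x z + dist z y.
Proof. by move/tpath_split => E; rewrite /dist E size_cat. Qed.

Lemma tpath_rcons x y z :
  e y z -> z \notin x :: tpath x y -> tpath x z = rcons (tpath x y) z.
Proof.
case: (tpathP x y) => pP uP lP yz zp; apply: tpath_eq; last by rewrite last_rcons.
- by rewrite rcons_path pP lP.
- by rewrite -rcons_cons rcons_uniq zp.
Qed.

Lemma dist_edge x y : e x y -> dist x y = 1.
Proof.
move=> xy; rewrite /dist (@tpath_eq x y [:: y]) //= ?xy // inE andbT.
by apply: contraTneq xy => ->; rewrite eI.
Qed.

(** Either [z] lies on the path from [x] to [y], or it prolongs that path. *)
Lemma dist_nbr x y z : e y z ->
  dist x y = (dist x z).+1 \/ dist x z = (dist x y).+1 /\ tpath x z = rcons (tpath x y) z.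
Proof.
move=> yz; case: (boolP (z \in x :: tpath x y)) => [/dist_split|] zp; [left|right].
  by rewrite zp (dist_edge (x := z)) ?addn1 // eS.
by have E := tpath_rcons yz zp; rewrite /dist E size_rcons.
Qed.

(** The path from [x] to [y] prolongs the paths to [z1] and to [z2], so both are its last vertex but
    one. *)
Lemma dist_parent_uniq x y z1 z2 : e y z1 -> e y z2 ->
  dist x y = (dist x z1).+1 -> dist x y = (dist x z2).+1 -> z1 = z2.
Proof.
rewrite ![e y _]eS => e1 e2 d1 d2.
case: (dist_nbr x e1) => [|[_ p1]]; first lia.
case: (dist_nbr x e2) => [|[_ p2]]; first lia.
have /eqP := etrans (esym p1) p2; rewrite eqseq_rcons => /andP[/eqP E _].
by case: (tpathP x z1) (tpathP x z2) => _ _ <- [_ _ <-]; rewrite E.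
Qed.

Lemma dist_parent x y : x != y -> exists2 z, e y z & dist x y = (dist x z).+1.
Proof.
case: (tpathP x y); case: (lastP (tpath x y)) => [_ _ /= ->|p w]; first by rewrite eqxx.
rewrite last_rcons rcons_path => /andP[pP ew] uP E _; subst w.
exists (last x p); rewrite 1?eS //; case: (@dist_nbr x y (last x p)) => // [|[dx _]].
  by rewrite eS.
have: y \notin x :: tpath x (last x p).
  move: uP; rewrite -rcons_cons rcons_uniq => /andP[yp up].
  by rewrite (@tpath_eq x _ p).
by move/(tpath_rcons ew)/(congr1 size); rewrite size_rcons.
Qed.

Lemma dist_triangle x y z : dist x z <= dist x y + dist y z.
Proof.
move dz: (dist y z) => k; elim: k z dz => [|k IH] z dz.
  by rewrite (dist0_eq dz) addn0.
have yz : y != z by rewrite -dist_eq0 dz.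
case: (dist_parent yz) => w zw; rewrite dz => -[] /esym/IH.
by case: (dist_nbr x zw) => [->|[-> _]]; lia.
Qed.

Lemma dist_lt_card x y : dist x y < #|T|.
Proof.
by case: (tpathP x y) => _ /card_uniqP /= <- _; apply: max_card.
Qed.

Lemma dist1 x y : (dist x y == 1) = e x y.
Proof.
apply/eqP/idP => [d1|/dist_edge //].
have xy : x != y by rewrite -dist_eq0 d1.
by case: (dist_parent xy) => z yz; rewrite d1 => -[] /esym/dist0_eq ->; rewrite eS.
Qed.

Lemma card_parent x y : x != y -> #|[set z | e y z & dist x y == (dist x z).+1]| = 1.
Proof.
case/dist_parent => w yw dw; apply/eqP/cards1P; exists w; apply/setP=> z; rewrite !inE.
apply/andP/eqP => [[yz /eqP dz]|->]; last by rewrite dw.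
exact: dist_parent_uniq dz dw.
Qed.

(** Seen from [x], every neighbour of [y] is either its single parent or one step farther away. *)
Lemma card_children x y : x != y ->
  degree e y = #|[set z | e y z & dist x z == (dist x y).+1]|.+1.
Proof.
move=> xy; rewrite /degree -addn1 -(card_parent xy) -cardsUI.
rewrite [X in _ = _ + X](_ : _ = 0) ?addn0.
  apply: eq_card => z; rewrite !inE -andb_orr; case: (boolP (e y z)) => //= yz.
  by case: (dist_nbr x yz) => [E|[E _]]; rewrite E eqxx ?orbT.
apply: eq_card0 => z; rewrite !inE; apply/negP.
by move=> /andP[/andP[_ /eqP Ez] /andP[_ /eqP Ey]]; lia.
Qed.

(** * Sphere sizes, and the distance between leaves *)

Definition sphere x h : {set T} := [set y | dist x y == h].

(** The degree of [y] counts its parent and its children. Exchanging the sums counts each vertex of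
    the next sphere once, at its unique parent. *)
Lemma card_sphereS x h : 0 < h ->
  #|sphere x h| + #|sphere x h.+1| = \sum_(y in sphere x h) degree e y.
Proof.
move=> h0; rewrite (eq_bigr (fun y => 1 + \sum_(z in sphere x h.+1 | e y z) 1)); last first.
  move=> y; rewrite inE => /eqP dy; rewrite (@card_children x) -?dist_eq0 ?dy -?lt0n // add1n.
  by rewrite sum1_card; congr (_.+1); apply: eq_card => z; rewrite [RHS]unfold_in !inE andbC.
rewrite big_split sum1_card /= (exchange_big_dep [in sphere x h.+1]) => [|? ? _ /andP[] //].
congr (_ + _).
rewrite -sum1_card; apply: eq_bigr => z; rewrite inE => /eqP dz.
have xz : x != z by rewrite -dist_eq0 dz.
rewrite sum1_card -(card_parent xz); apply: eq_card => y.
by rewrite [RHS]unfold_in /= !inE dz eqxx eqSS [h == _]eq_sym eS andbC.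
Qed.

(* Otherwise the vertices of the path from [x] to [y] would form a set closed under
   adjacency. *)
Lemma dist_leaves v0 x y :
    (forall v, 2 < degree e v -> v = v0) ->
    degree e x = 1 -> degree e y = 1 -> x != y ->
  dist x y = dist v0 x + dist v0 y.
Proof.
move=> deg_le2 dx dy xy.
(* [S] describes the vertices of the path from [x] to [y] by distances. *)
pose S := [set z | dist x y == dist x z + dist z y].
suff: v0 \in S by rewrite inE (dist_sym x v0) => /eqP.
apply/negPn/negP => nS.
suff clS : closed e S.
  by move: nS; rewrite -(closed_connect clS (conn x v0)) inE distxx eqxx.
apply: intro_closed; first exact: sym_connect_sym.
move=> z w zw Sz; move: (Sz); rewrite !inE => /eqP Ez.
(* The only neighbour of a leaf is its parent, seen from any other vertex. *)
have parentS u v z' : degree e u = 1 -> u != v -> e u z' -> dist v u = (dist v z').+1.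
  move=> du; rewrite eq_sym => uv uz'; case: (dist_parent uv) => u' uu' ->.
  have /eqP/cards1P[t Et] := du.
  have: z' \in [set t] by rewrite -Et inE.
  have: u' \in [set t] by rewrite -Et inE.
  by rewrite !inE => /eqP-> /eqP->.
have [Exz|xz] := eqVneq x z.
  subst z; have := parentS _ _ _ dx xy zw; rewrite (dist_edge zw) !(dist_sym _ y); lia.
have [Eyz|yz] := eqVneq y z.
  subst z; rewrite eq_sym in xy; have := parentS _ _ _ dy xy zw.
  rewrite -(dist_sym y w) (dist_edge zw); lia.
(* An inner vertex [z] of the path has no neighbours besides its parents towards [x] and towards
   [y], and both lie in [S]. *)
have dz : degree e z <= 2.
  by rewrite leqNgt; apply/negP => /deg_le2 E; move: nS; rewrite -E Sz.
case: (dist_parent xz) => zx zzx dzx; case: (dist_parent yz) => zy zzy dzy.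
rewrite !(dist_sym _ y) in Ez *.
have Tzx := dist_triangle x zx y; have Tzy := dist_triangle x zy y.
rewrite !(dist_sym _ y) in Tzx Tzy.
have zxy : zx != zy by apply: contraTneq isT => E; rewrite -E in dzy; lia.
have : w \in [set zx; zy].
  have /eqP -> : [set zx; zy] == [set u | e z u].
    by rewrite eqEcard cards2 zxy dz andbT; apply/subsetP=> u; rewrite !inE => /orP[]/eqP->.
  by rewrite inE.
rewrite !inE => /orP[]/eqP->.
- by case: (dist_nbr y zzx) => [|[]]; lia.
- by case: (dist_nbr x zzy) => [|[]]; lia.
Qed.

(** * Undirected paths as unordered pairs of vertices *)

Definition tpath_subgraph (p : T * T) := path_subgraph (p.1 :: tpath p.1 p.2).

Lemma tpath_subgraph_sym x y : tpath_subgraph (x, y) = tpath_subgraph (y, x).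
Proof. by rewrite /tpath_subgraph /= (tpath_sym x y) path_subgraph_rev. Qed.

Lemma tpath_subgraph_last x y u v :
  tpath_subgraph (x, y) = tpath_subgraph (u, v) -> y \in u :: tpath u v.
Proof.
move/(congr1 fst)/setP/(_ y); rewrite /= !in_set => <-.
by case: (tpathP x y) => _ _ {1}<-; apply: mem_last.
Qed.

(** Both [x] and [y] lie on the path from [u] to [v], and their distance is its full length, so they
    are its ends. *)
Lemma tpath_subgraph_inj x y u v :
    dist x y = dist u v -> tpath_subgraph (x, y) = tpath_subgraph (u, v) ->
  (x, y) = (u, v) \/ (x, y) = (v, u).
Proof.
move=> dxy Exy; have yuv := tpath_subgraph_last Exy.
rewrite tpath_subgraph_sym in Exy; have xuv := tpath_subgraph_last Exy.
have := dist_split xuv; move: yuv.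
rewrite (tpath_split xuv) -cat_cons mem_cat => /orP[yux|yxv] duv.
  have dux := dist_split yux; rewrite (dist_sym y x) in dux.
  by right; congr pair; apply: dist0_eq; rewrite 1?(dist_sym y u); lia.
have dxv : dist x v = dist x y + dist y v by apply: dist_split; rewrite inE yxv orbT.
by left; congr pair; apply: dist0_eq; rewrite 1?(dist_sym x u); lia.
Qed.

Lemma is_vertex_path_tpath x y : is_vertex_path e (x :: tpath x y).
Proof. by case: (tpathP x y) => pP uP _; rewrite /is_vertex_path uP. Qed.

Lemma vertex_path_tpath x p : is_vertex_path e (x :: p) -> tpath x (last x p) = p.
Proof. by case/andP=> uP pP; apply: tpath_eq. Qed.

Lemma paths_tpath h :
  paths e h = [set tpath_subgraph p | p in [set p : T * T | dist p.1 p.2 == h]].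
Proof.
apply/setP=> g; apply/imsetP/imsetP => [[t]|[[x y]]]; rewrite inE => ht ->.
  case/tupleP: t ht => x p xp; exists (x, last x p); last first.
    by rewrite /tpath_subgraph vertex_path_tpath.
  by rewrite inE /dist vertex_path_tpath // size_tuple.
have sz : size (x :: tpath x y) == h.+1 by rewrite /= eqSS.
by exists (Tuple sz); rewrite ?inE //=; apply: is_vertex_path_tpath.
Qed.

(** Each path comes from its two ordered pairs of ends, which differ because [h] is positive. *)
Lemma double_num_paths h : 0 < h ->
  \sum_x #|sphere x h| = (num_paths e h).*2.
Proof.
move=> h0; transitivity #|[set p : T * T | dist p.1 p.2 == h]|.
  rewrite -sum1_card (eq_bigl (fun p : T * T => dist p.1 p.2 == h)); last first.
    by move=> p; rewrite inE.
  rewrite -(pair_big_dep xpredT (fun x y => dist x y == h) (fun _ _ => 1)) /=.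
  by apply: eq_bigr => x _; rewrite sum1dep_card.
rewrite /num_paths paths_tpath -sum1_card (partition_big_imset tpath_subgraph) /=.
rewrite -mul2n mulnC -sum_nat_const.
apply: eq_bigr => _ /imsetP[[x y] /[!inE] /= /eqP dxy ->].
rewrite sum1_card -[RHS](_ : #|[set (x, y); (y, x)]| = 2); last first.
  rewrite cards2 xpair_eqE; suff /negPf-> : x != y by [].
  by rewrite -dist_eq0 dxy -lt0n.
apply: eq_card => -[u v]; rewrite [LHS]unfold_in /= !inE /=.
apply/andP/orP => [[/eqP duv /eqP]|[]/eqP[-> ->]].
- by move/tpath_subgraph_inj; rewrite dxy duv => /(_ erefl)[]->; [left|right].
- by rewrite dxy !eqxx.
- by rewrite dist_sym dxy tpath_subgraph_sym !eqxx.
Qed.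

(** * Branches, leaves and the counting recursions of a starlike tree *)

Definition leaves : {set T} := [set y | degree e y == 1].

(** With one end fixed at [v0], a branch is determined by its leaf. *)
Lemma num_branches_leaves v0 l :
  num_branches e v0 l = #|leaves :&: sphere v0 l|.
Proof.
rewrite -(@card_in_imset _ _ (fun y => tpath_subgraph (v0, y))); last first.
  move=> y z; rewrite !inE => /andP[_ /eqP dy] /andP[_ /eqP dz].
  case/tpath_subgraph_inj; rewrite ?dy ?dz //; first by case.
  by case=> -> ->.
congr #|pred_of_set _|; apply/setP=> g; apply/imsetP/imsetP => [[t]|[y]].
  rewrite inE; case/tupleP: t => x p /and3P[xp]; rewrite theadE => /eqP E.
  subst x => /= leaf ->.
  exists (last v0 p); last by rewrite /tpath_subgraph /= vertex_path_tpath.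
  by rewrite !inE leaf /dist vertex_path_tpath // size_tuple eqxx.
rewrite !inE => /andP[leaf /eqP dy] ->.
have sz : size (v0 :: tpath v0 y) == l.+1 by rewrite /= eqSS; apply/eqP.
exists (Tuple sz) => //; rewrite inE is_vertex_path_tpath /= /thead (tnth_nth v0) /= eqxx.
by case: (tpathP v0 y) => _ _ ->.
Qed.

Section Starlike.

Variable v0 : T.
Hypothesis deg_v0 : forall v, 2 < degree e v <-> v = v0.

Let m := degree e v0.
Let L := num_branches e v0.

Lemma root_not_leaf : v0 \notin leaves.
Proof. by rewrite inE; have /deg_v0 := erefl v0; case: (degree e v0) => [|[]]. Qed.

Lemma degree_starlike y : degree e y + (y \in leaves) = 2 + (y == v0) * (m - 2).
Proof.
have m2 : 2 < m by apply/deg_v0.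
have [->|yv0] := eqVneq y v0; first by rewrite (negPf root_not_leaf) mul1n -/m; lia.
have : degree e y <= 2 by rewrite leqNgt; apply/negP => /deg_v0/eqP; rewrite (negPf yv0).
(* Seen from [v0], the vertex [y] has a parent, so its degree is not 0. *)
rewrite inE (@card_children v0) 1?eq_sym //.
by case: #|_| => [|[]].
Qed.

(** The common source of the three recursions: the degrees, equal to 2 up to corrections at the
    leaves and the root, are inserted into [card_sphereS]. *)
Lemma card_sphere_starlike x h : 0 < h ->
  #|sphere x h.+1| + #|leaves :&: sphere x h| =
  #|sphere x h| + (dist x v0 == h) * (m - 2).
Proof.
move=> h0; apply: (@addnI #|sphere x h|).
rewrite addnA card_sphereS // -sum_mem -big_split /=.
rewrite (eq_bigr _ (fun y _ => degree_starlike y)) big_split sum_nat_const -big_distrl /=.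
rewrite muln2 -addnn -addnA; congr (_ + (_ + _ * _)).
have := sum_mem (sphere x h) [set v0]; rewrite (eq_bigr (fun y => (y == v0) : nat)); last first.
  by move=> y _; rewrite inE.
by move->; rewrite setIC -sum_mem big_set1 inE.
Qed.

Lemma card_sphere1 x : #|sphere x 1| = degree e x.
Proof. by apply: eq_card => y; rewrite !inE dist1. Qed.

Lemma sum_sphere_mem h (A : {set T}) :
  \sum_x #|A :&: sphere x h| = \sum_(y in A) #|sphere y h|.
Proof.
under eq_bigr => x _ do rewrite setIC -sum_mem.
rewrite exchange_big; apply: eq_bigr => y _ /=.
rewrite -sum1_card [RHS]big_mkcond; apply: eq_bigr => x _.
by rewrite !inE dist_sym; case: (_ == _).
Qed.

(** The recursion for [C], written without subtraction. *)
Lemma sum_spheresS h : 0 < h ->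
  \sum_x #|sphere x h.+1| + \sum_(x in leaves) #|sphere x h| =
  \sum_x #|sphere x h| + #|sphere v0 h| * (m - 2).
Proof.
move=> h0; rewrite -sum_sphere_mem -big_split /=.
rewrite (eq_bigr _ (fun x _ => card_sphere_starlike x h0)) big_split -big_distrl /=.
congr (_ + _ * _).
rewrite -sum1_card [RHS]big_mkcond; apply: eq_bigr => x _.
by rewrite !inE dist_sym; case: (_ == _).
Qed.

(** The recursion for [N]: the root term vanishes, as [v0] has distance 0 from itself. *)
Lemma card_root_sphereS h : 0 < h -> #|sphere v0 h.+1| + L h = #|sphere v0 h|.
Proof.
move=> h0; rewrite /L num_branches_leaves card_sphere_starlike // distxx.
by case: h h0 => // h _; rewrite addn0.
Qed.

(** The recursion for [Q]. *)
Lemma sum_leaf_spheresS h : 0 < h ->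
  \sum_(x in leaves) #|sphere x h.+1| + \sum_(x in leaves) #|leaves :&: sphere x h| =
  \sum_(x in leaves) #|sphere x h| + L h * (m - 2).
Proof.
move=> h0; rewrite -big_split /=.
rewrite (eq_bigr _ (fun x _ => card_sphere_starlike x h0)) big_split -big_distrl /=.
congr (_ + _ * _).
rewrite /L num_branches_leaves setIC -sum_mem; apply: eq_bigr => x _.
by rewrite !inE dist_sym.
Qed.

Lemma dist_leaf_gt0 x : x \in leaves -> 0 < dist v0 x.
Proof.
by move=> lx; rewrite lt0n dist_eq0; apply: contraTneq lx => <-; apply: root_not_leaf.
Qed.

Lemma sum_leaves_by_depth (F : nat -> nat) k :
  \sum_(1 <= a < k) L a * F a = \sum_(x in leaves | dist v0 x < k) F (dist v0 x).
Proof.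
under eq_bigr => a _ do rewrite /L num_branches_leaves setIC -sum_mem big_distrl /=.
rewrite exchange_big [RHS]big_mkcondr; apply: eq_bigr => x lx /=.
transitivity (\sum_(1 <= a < k | a == dist v0 x) F a).
  rewrite [RHS]big_mkcond; apply: eq_bigr => a _; rewrite inE eq_sym.
  by case: eqP => _; rewrite ?mul1n.
by rewrite big_nat1_eq dist_leaf_gt0.
Qed.

Lemma card_leaves : #|leaves| = m.
Proof.
(* The recursion for [N] telescopes; beyond distance [#|T|] the sphere is empty and only leaves
   remain. *)
have N k : #|sphere v0 k.+1| + \sum_(1 <= l < k.+1) L l = m.
  elim: k => [|k IH]; first by rewrite big_geq // addn0 card_sphere1.
  by rewrite big_nat_recr //= [X in _ + X]addnC addnA card_root_sphereS.
rewrite -(N #|T|) [X in X + _](_ : _ = 0); last first.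
  by apply: eq_card0 => y; rewrite !inE ltn_eqF // ltnS ltnW ?dist_lt_card.
rewrite add0n; under eq_bigr => l _ do rewrite -[L l]muln1.
rewrite (sum_leaves_by_depth (fun=> 1)) -sum1_card; apply: eq_bigl => x.
by have := dist_lt_card v0 x; rewrite ltnS => /ltnW->; rewrite andbT.
Qed.

(** The degree sum; the summand [m] on the left counts the leaves. *)
Lemma sum_sphere1 : \sum_x #|sphere x 1| + m = 2 * #|T| + (m - 2).
Proof.
rewrite -{1}card_leaves -[X in _ + X = _]sum1_card [X in _ + X = _]big_mkcond -big_split /=.
rewrite (eq_bigr (fun y => 2 + (y == v0) * (m - 2))); last first.
  by move=> y _; rewrite -degree_starlike card_sphere1; case: (y \in _).
rewrite big_split sum_nat_const -big_distrl mulnC /=; congr (_ + _).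
rewrite (bigD1 v0) //= eqxx big1 ?mul1n // => y /negPf-> //.
Qed.

Lemma sum_leaf_sphere1 : \sum_(x in leaves) #|sphere x 1| = m.
Proof.
by rewrite -card_leaves -sum1_card; apply: eq_bigr => x; rewrite card_sphere1 inE => /eqP.
Qed.

(** Distinct leaves at distance [k] have depths [a] and [k - a]. The products on the right also pair
    a leaf with itself when [a = k - a]; the second sum on the left accounts for this. *)
Lemma sum_leaf_pairs k : 0 < k ->
  \sum_(x in leaves) #|leaves :&: sphere x k| + \sum_(1 <= a < k) L a * (a == k - a) =
  \sum_(1 <= a < k) L a * L (k - a).
Proof.
move=> k0.
rewrite (sum_leaves_by_depth (fun a => a == k - a :> nat)).
rewrite (sum_leaves_by_depth (fun a => L (k - a))).
have leafS x y : x \in leaves -> y \in leaves -> x != y ->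
    dist x y = dist v0 x + dist v0 y.
  by rewrite !inE => /eqP dx /eqP dy; apply: dist_leaves => // v /deg_v0.
(* A leaf of depth at least [k] has no partner, since the partner's depth is positive. *)
rewrite (bigID (fun x => dist v0 x < k)) /= [X in _ + X + _]big1 ?addn0; last first.
  move=> x /andP[lx dx]; apply: eq_card0 => y; rewrite [RHS]inE; apply/negP.
  rewrite in_setI => /andP[ly]; rewrite inE => /eqP dxy; have := dist_leaf_gt0 ly.
  have xy : x != y by rewrite -dist_eq0 dxy -lt0n.
  by have := leafS _ _ lx ly xy; lia.
rewrite -big_split; apply: eq_bigr => x /andP[lx dx] /=.
rewrite /L num_branches_leaves [RHS](cardsD1 x) addnC in_setI lx /= inE; congr (_ + _).
apply: eq_card => y; rewrite in_setD1 !in_setI.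
have [->|yx] /= := eqVneq y x.
  by rewrite [_ \in sphere _ _]inE distxx eq_sym (gtn_eqF k0) andbF.
case: (boolP (y \in leaves)) => //= ly.
by rewrite !inE leafS 1?eq_sym //; apply/eqP/eqP; lia.
Qed.

End Starlike.

End TreeDistance.

Import GRing.Theory Num.Theory.
Local Open Scope ring_scope.

(** * The solved recursions over a commutative ring *)

Section PathFormula.

Variable R : comNzRingType.
Implicit Types (n m : R) (L : nat -> R).

(* These express [N k], [B k], [Q k] and [C k] of the header through the branch
   numbers, for [k > 0]. *)
Definition root_sum m L k := m - \sum_(1 <= l < k) L l.

Definition leaf_pair_sum L k :=
  \sum_(1 <= a < k) L a * (L (k - a)%N - (a == k - a)%N%:R).

Definition leaf_sum m L k :=
  m + \sum_(1 <= j < k) (L j * (m - 2) - leaf_pair_sum L j).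

Definition path_sum n m L k :=
  2 * n - 2 + \sum_(1 <= j < k) (root_sum m L j * (m - 2) - leaf_sum m L j).

Section Ext.

Variables (m : R) (L L' : nat -> R) (k : nat).
Hypothesis eqL : forall l, (0 < l < k)%N -> L l = L' l.

Lemma eq_root_sum : root_sum m L k = root_sum m L' k.
Proof. by congr (_ - _); apply: eq_big_nat. Qed.

Lemma eq_leaf_pair_sum : leaf_pair_sum L k = leaf_pair_sum L' k.
Proof. by apply: eq_big_nat => a ak; rewrite !eqL //; lia. Qed.

End Ext.

Lemma eq_leaf_sum m L L' k :
  (forall l, (0 < l < k)%N -> L l = L' l) -> leaf_sum m L k = leaf_sum m L' k.
Proof.
move=> eqL; congr (_ + _); apply: eq_big_nat => j jk.
rewrite (eqL j) // (@eq_leaf_pair_sum L L') // => l lj; apply: eqL; lia.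
Qed.

(** [L k.+1] occurs only in the summand [j = k.+2]: once through [root_sum] and once through
    [leaf_sum], each time contributing [- (m - 2) * L k.+1]. *)
Lemma path_sum_split n m L L' k :
    (forall l, (0 < l <= k)%N -> L l = L' l) -> L' k.+1 = 0 ->
  path_sum n m L k.+3 = path_sum n m L' k.+3 - 2 * (m - 2) * L k.+1.
Proof.
move=> eqL L'0; rewrite /path_sum ![\sum_(1 <= j < k.+3) _]big_nat_recr //=.
rewrite (@eq_big_nat _ _ _ 1 k.+2 _
  (fun j => root_sum m L' j * (m - 2) - leaf_sum m L' j)); last first.
  move=> j jk; rewrite (@eq_root_sum m L L') 1?(@eq_leaf_sum m L L') // => l lj;
    apply: eqL; lia.
have -> : root_sum m L k.+2 = root_sum m L' k.+2 - L k.+1.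
  rewrite /root_sum !(@big_nat_recr _ _ _ k.+1) //= L'0 addr0 opprD addrA.
  by congr (_ - _ - _); apply: eq_big_nat => l lk; apply: eqL; lia.
(* [leaf_pair_sum] at [k.+1] reads indices up to [k] only, so [L k.+1] enters linearly. *)
have -> : leaf_sum m L k.+2 = leaf_sum m L' k.+2 + L k.+1 * (m - 2).
  rewrite /leaf_sum !(@big_nat_recr _ _ _ k.+1) //= L'0 mul0r sub0r.
  have := @eq_leaf_sum m L L' k.+1 eqL; rewrite /leaf_sum => /addrI ->.
  by rewrite (@eq_leaf_pair_sum L L') //; ring.
by ring.
Qed.

End PathFormula.

(** * The counts of a starlike tree satisfy the formulas *)

Section StarlikeFormula.

Variables (R : comNzRingType) (T : finType) (e : rel T) (v0 : T).
Hypothesis eS : symmetric e.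
Hypothesis eI : irreflexive e.
Hypothesis star : starlike_tree e v0.

Let conn := star.1.1.
Let acyc := star.1.2.
Let deg_v0 := star.2.
Let m := degree e v0.
Let L l : R := (num_branches e v0 l)%:R.
Local Notation sphere := (sphere conn).

(** The root has degree above 2, so the truncated subtraction is exact. *)
Let natrm : (m - 2)%:R = m%:R - 2 :> R.
Proof. by rewrite natrB //; apply/ltnW/deg_v0. Qed.

Lemma card_root_sphere k : (0 < k)%N -> #|sphere v0 k|%:R = root_sum m%:R L k.
Proof.
rewrite /root_sum; elim: k => // -[|k] IH _; first by rewrite big_geq // subr0 card_sphere1.
rewrite big_nat_recr //= opprD addrA -IH //.
by rewrite -(@card_root_sphereS _ _ eS eI conn acyc _ deg_v0 k.+1) // natrD addrK.
Qed.

Lemma card_leaf_pairs k : (0 < k)%N ->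
  (\sum_(x in leaves e) #|leaves e :&: sphere x k|)%:R = leaf_pair_sum L k.
Proof.
move=> k0; have /(congr1 (GRing.natmul (1 : R))) := sum_leaf_pairs eS eI conn acyc deg_v0 k0.
rewrite natrD => /(canRL (addrK _)) ->; rewrite !natr_sum -sumrB.
by apply: eq_bigr => a _; rewrite !natrM mulrBr.
Qed.

Lemma card_leaf_spheres k : (0 < k)%N ->
  (\sum_(x in leaves e) #|sphere x k|)%:R = leaf_sum m%:R L k.
Proof.
rewrite /leaf_sum; elim: k => // -[|k] IH _.
  by rewrite big_geq // addr0 (sum_leaf_sphere1 eS eI conn acyc deg_v0).
rewrite big_nat_recr //= addrA -IH // -card_leaf_pairs //.
have /(congr1 (GRing.natmul (1 : R))) := sum_leaf_spheresS eS eI conn acyc deg_v0 (ltn0Sn k).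
by rewrite !natrD natrM natrm => /(canRL (addrK _)) ->; rewrite addrA.
Qed.

Lemma num_paths_path_sum h : (0 < h)%N ->
  2 * (num_paths e h)%:R = path_sum #|T|%:R m%:R L h.
Proof.
move=> h0; rewrite -natrM mul2n -(double_num_paths eS conn acyc h0).
rewrite /path_sum; elim: h h0 => // -[|k] IH _.
  rewrite big_geq // addr0.
  have /(congr1 (GRing.natmul (1 : R))) := sum_sphere1 eS eI conn acyc deg_v0.
  by rewrite natrD [RHS]natrD natrM natrm => /(canRL (addrK _)) ->; ring.
rewrite big_nat_recr //= addrA -IH // -card_leaf_spheres // -card_root_sphere //.
have /(congr1 (GRing.natmul (1 : R))) := sum_spheresS eS eI conn acyc deg_v0 (ltn0Sn k).
by rewrite !natrD natrM natrm => /(canRL (addrK _)) ->; rewrite addrA.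
Qed.

End StarlikeFormula.

Theorem theorem6 (R : realType) :
  exists lambda mu : nat -> nat -> nat -> seq nat -> R,
    forall (T : finType) (e : rel T) (v0 : T) (n m h : nat),
      simple_graph e ->
      starlike_tree e v0 ->
      #|T| = n ->
      degree e v0 = m ->
      (2 < h)%N ->
      let L := num_branches e v0 in
      let Ls := [seq L l | l <- iota 1 (h - 3)] in
      (num_paths e h)%:R = lambda n m h Ls + mu n m h Ls * (L (h - 2)%N)%:R
      /\ mu n m h Ls = 2 - m%:R.
Proof.
(* The leading [0] makes position [l] of the list hold [L l]; beyond the end [nth]
   returns [0], so that the contribution of [L (h - 2)] is left out. *)
exists (fun n m h Ls => path_sum n%:R m%:R (fun l => (nth 0%N (0%N :: Ls) l)%:R) h / 2).
exists (fun _ m _ _ => 2 - m%:R).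
move=> T e v0 n m h [eS eI] star <- <- h2 /=; split=> //.
(* With [h = k + 3] the list holds [L 1, ..., L k], and [L (h - 2)] is [L k.+1]. *)
case: h h2 => [|[|[|k]]] // _; rewrite !subSS !subn0.
set L' := fun l => _.
have := num_paths_path_sum R eS eI star (ltn0Sn k.+2).
rewrite (@path_sum_split _ _ _ (fun l => (num_branches e v0 l)%:R) L' k).
(* [path_sum] counts ordered pairs; halving turns [- 2 * (m - 2)] into [2 - m]. *)
- move=> E; apply: (@mulfI R 2); first by rewrite pnatr_eq0.
  by rewrite E; field.
- by case=> // l lk; rewrite /L' /= (nth_map 0%N) ?size_iota // nth_iota.
- by rewrite /L' /= nth_default // size_map size_iota.
Qed.
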